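(* A counter system $\mathcal{C}=(C,Q,\mathcal{T})$ is fully $\preceq_0$-compatible if its set of steps $\mathcal{T}$ can be partitioned into sets $\mathcal{T}_i$ such that full $\preceq_0$-compatibility holds for each set (i.e. each $(C,Q,\mathcal{T}_i)$ is fully $\preceq_0$-compatible). In particular, a counter system is fully $\preceq_0$-compatible if each of its steps is induced by one of the following transition types: internal, disjunctive guard, lossy broadcast, synchronization, guarded synchronization, or asynchronous shared memory (ASM).
   Context: For $\mathbf{v}\in\mathbb{N}^Q$ let $|\mathbf{v}|=\sum_{q\in Q}\mathbf{v}(q)$ and $\mathrm{supp}(\mathbf{v})=\{q\in Q\mid\mathbf{v}(q)\ge1\}$; for $q\in Q$ let $\mathbf{q}\in\mathbb{N}^Q$ be the multiset with one occurrence of $q$. A counter system (CS) is a triple $\mathcal{C}=(C,Q,\mathcal{T})$ with $C$ a finite set (controller states), $Q$ a finite set (user states), and a size-preserving step relation $\mathcal{T}\subseteq(C\times\mathbb{N}^Q)\times(C\times\mathbb{N}^Q)$ ($|\mathbf{v}|=|\mathbf{v}'|$ whenever $((c,\mathbf{v}),(c',\mathbf{v}'))\in\mathcal{T}$). Write $(c,\mathbf{v})\to(c',\mathbf{v}')$ for $((c,\mathbf{v}),(c',\mathbf{v}'))\in\mathcal{T}$. A configuration $(c,\mathbf{v})$ represents one controller process in state $c$ and $\mathbf{v}(q)$ user processes in each state $q$. Order: $(c,\mathbf{v})\preceq_0(d,\mathbf{w})$ iff $c=d$ and, for all $q\in Q$, $\mathbf{v}(q)\le\mathbf{w}(q)$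 and $(\mathbf{v}(q)=0\Leftrightarrow\mathbf{w}(q)=0)$. $\mathcal{C}$ is forward $\preceq_0$-compatible if whenever $(c,\mathbf{v})\to(c',\mathbf{v}')$ and $(c,\mathbf{v})\preceq_0(d,\mathbf{w})$, there is a step $(d,\mathbf{w})\to(d',\mathbf{w}')$ with $(c',\mathbf{v}')\preceq_0(d',\mathbf{w}')$. It is backward $\preceq_0$-compatible if whenever $(c,\mathbf{v})\to(c',\mathbf{v}')$ and $(c',\mathbf{v}')\preceq_0(d',\mathbf{w}')$, there is a step $(d,\mathbf{w})\to(d',\mathbf{w}')$ with $(c,\mathbf{v})\preceq_0(d,\mathbf{w})$. Fully $\preceq_0$-compatible means both. Steps are made of local transitions taken simultaneously by distinct processes, each process taking at most one transition. A user process taking a transition from $p$ to $q$ ($p,q\in Q$) must be in $p$ and moves to $q$ (contributing $-\mathbf{p}+\mathbf{q}$ to $\mathbf{v}$); the controller taking a transition from $p$ to $q$ ($p,q\in C$) must be in $p$ and moves to $q$. Processes taking no transition stay where they are. In the second part of the claim, $\mathcal{T}$ is the set of all steps defined by a finite set of local transitions of the following types (possibly of several types): - Internal. Transitions $p\to q$ with $p,q\in C$ or $p,q\in Q$. A step consists of one or more processes taking the same transition. - Lossy broadcast. Transitions $p\xrightarrow{l}q$ with $p,q\in C$ or $p,q\in Q$ and $l\in\{!a,?a\mid a\in\Sigma\}$, $\Sigma$ a finite alphabet. A step consists of one or more processes taking the same broadcast transition $p\xrightarrow{!a}p'$ and an arbitrary number $k\ge0$ of other processes taking receive transitions $p_1\xrightarrow{?a}p_1',\dots,p_k\xrightarrow{?a}p_k'$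 with the same letter $a$. - Disjunctive guard. Transitions $p\xrightarrow{G_\exists}q$ with $p,q\in C$ or $p,q\in Q$ and $G_\exists\subseteq C\cup Q$. A configuration $(c,\mathbf{v})$ satisfies $G_\exists$ if $c\in G_\exists$ or $\mathbf{v}(r)\ge1$ for some $r\in G_\exists$. A step consists of one or more processes taking the same transition $p\xrightarrow{G_\exists}q$ from a configuration satisfying $G_\exists$ such that the resulting configuration also satisfies $G_\exists$. - Synchronization. Transitions $p\xrightarrow{a}q$ with $a\in\Sigma$ ($\Sigma$ a finite set of labels) and $p,q\in C$ or $p,q\in Q$. In a step on $a$, all processes (controller and users) take a transition with label $a$ if one is available from their current state (choosing one if several are available), and otherwise stay. - Guarded synchronization. Transitions $p\xrightarrow{a,(G_\exists,G_\forall)}q$ with $G_\exists,G_\forall\subseteq C\cup Q$. Steps are as for synchronization, with label $a,(G_\exists,G_\forall)$, but are enabled from $(c,\mathbf{v})$ only if $S=\mathrm{supp}(\mathbf{v})\cup\{c\}$ satisfies $S\cap G_\exists\neq\emptyset$ and $S\subseteq G_\forall$. - ASM. Transitions $p\xrightarrow{l}q$ with $p,q\in Q$ and $l\in\{w(a),r(a)\mid a\in C\}$; in addition a controller transition $a\to b$ is available for all $a,b\in C$. A write step from $(c,\mathbf{v})$ consists of one or more user processes taking the same transition $p\xrightarrow{w(a)}q$ and the controller moving $c\to a$. A read step consists of one or more user processes taking the same transition $p\xrightarrow{r(a)}q$ and the controller taking $a\to a$ (so $c=a$ is required). *)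

(* Defs.v *)
From mathcomp Require Import classical_sets.
From mathcomp Require Import all_boot.

Set Implicit Arguments.
Unset Strict Implicit.
Unset Printing Implicit Defensive.

Local Open Scope nat_scope.

Definition config (C Q : finType) : Type := (C * {ffun Q -> nat})%type.

Definition msize (Q : finType) (v : {ffun Q -> nat}) : nat := \sum_q v q.

Record counter_system (C Q : finType) := CounterSystem {
  steps : set (config C Q * config C Q);
  steps_size : forall x y, steps (x, y) -> msize x.2 = msize y.2
}.

Section Order.

Variables C Q : finType.
Implicit Types (x y : config C Q) (S : counter_system C Q).

Definition prec0 x y : Prop :=
  x.1 = y.1 /\
  forall q, x.2 q <= y.2 q /\ (x.2 q = 0 <-> y.2 q = 0).

Definition forward_compatible S : Prop :=
  forall x x' y, steps S (x, x') -> prec0 x y ->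
    exists2 y', steps S (y, y') & prec0 x' y'.

Definition backward_compatible S : Prop :=
  forall x x' y', steps S (x, x') -> prec0 x' y' ->
    exists2 y, steps S (y, y') & prec0 x y.

Definition fully_compatible S : Prop :=
  forward_compatible S /\ backward_compatible S.

End Order.

Section LocalTransitions.

Variables C Q Sigma : finType.

(* A change of local state p -> q, by the controller (p, q in C) or by a user
   process (p, q in Q). *)
Definition edge : Type := ((C * C) + (Q * Q))%type.

(* The sets are finite because C, Q and Sigma are; any of them may be empty,
   so a system may use any combination of the transition types. *)
Record local_transitions := LocalTransitions {
  internal : {set edge};
  send : {set edge * Sigma};
  receive : {set edge * Sigma};
  disjunctive : {set edge * {set C + Q}};
  sync : {set edge * Sigma};
  (* the label is (a, G_exists, G_forall) *)
  guarded_sync : {set edge * (Sigma * {set C + Q} * {set C + Q})};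
  asm_write : {set Q * Q * C};
  asm_read : {set Q * Q * C}
}.

Implicit Types (D : local_transitions) (x y : config C Q) (e : edge).
Implicit Types (G : {set C + Q}) (o : option (C * C)) (m : {ffun Q * Q -> nat}).

(* The effect of a simultaneous choice of moves by distinct processes: o is the
   move of the controller, if any, and m t is the number of user processes
   taking the move t. The bound on the number of processes leaving p expresses
   that each of them takes at most one transition (and makes the natural number
   subtraction exact). *)
Definition moves o m x y : Prop :=
  [/\ (if o is Some (p, q) then x.1 = p /\ y.1 = q else y.1 = x.1),
      forall p, \sum_q m (p, q) <= x.2 p
    & forall q, y.2 q = x.2 q - \sum_r m (q, r) + \sum_p m (p, q)].

Definition copies (k : nat) (t : Q * Q) : {ffun Q * Q -> nat} :=
  [ffun s => if s == t then k else 0].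

(* One or more processes, exactly one in the case of the controller, take e. *)
Variant one_or_more : edge -> option (C * C) -> {ffun Q * Q -> nat} -> Prop :=
| OneController t : one_or_more (inl t) (Some t) [ffun=> 0]
| ManyUsers t k : 0 < k -> one_or_more (inr t) None (copies k t).

Definition support x : {set C + Q} :=
  [set s | match s with inl c => c == x.1 | inr q => 1 <= x.2 q end].

Definition sat_exists G x : Prop :=
  inl x.1 \in G \/ exists2 r, inr r \in G & 1 <= x.2 r.

Definition only_in (A : {set edge}) o m : Prop :=
  (forall t, o = Some t -> inl t \in A) /\
  (forall t, 0 < m t -> inr t \in A).

(* Every process for which A contains a transition from its current state takes
   such a transition, and the other processes stay. *)
Definition synchronized (A : {set edge}) o m x : Prop :=
  [/\ only_in A o m,
      (exists q, inl (x.1, q) \in A) -> o <> None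
    & forall p, (exists q, inr (p, q) \in A) -> \sum_q m (p, q) = x.2 p].

Variant step D x y : Prop :=
| InternalStep e o m of
    e \in internal D & one_or_more e o m & moves o m x y
| ControllerBroadcastStep t a m of
    (inl t, a) \in send D &
    only_in [set e | (e, a) \in receive D] None m &
    moves (Some t) m x y
| UserBroadcastStep t k a o m of
    (inr t, a) \in send D & 0 < k &
    only_in [set e | (e, a) \in receive D] o m &
    moves o [ffun s => copies k t s + m s] x y
| DisjunctiveStep e G o m of
    (e, G) \in disjunctive D & one_or_more e o m &
    sat_exists G x & sat_exists G y & moves o m x y
  (* the labels of synchronization steps are those of the transitions in D *)
| SyncStep e a o m of
    (e, a) \in sync D &
    synchronized [set f | (f, a) \in sync D] o m x & moves o m x y
| GuardedSyncStep e a GE GA o m of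
    (e, (a, GE, GA)) \in guarded_sync D &
    (exists s, s \in support x :&: GE) & support x \subset GA &
    synchronized [set f | (f, (a, GE, GA)) \in guarded_sync D] o m x &
    moves o m x y
| WriteStep t a k of
    (t, a) \in asm_write D & 0 < k & moves (Some (x.1, a)) (copies k t) x y
| ReadStep t a k of
    (t, a) \in asm_read D & 0 < k & moves (Some (a, a)) (copies k t) x y.

Lemma moves_size o m x y : moves o m x y -> msize x.2 = msize y.2.
Proof.
case=> _ le_m eq_y; rewrite /msize (eq_bigr _ (fun q _ => eq_y q)).
rewrite big_split /= [X in _ + X]exchange_big -big_split /=.
by apply: eq_bigr => q _; rewrite subnK.
Qed.

Lemma step_size D x y : step D x y -> msize x.2 = msize y.2.
Proof. by case=> *; apply: moves_size; eassumption. Qed.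

Definition induced_system D : counter_system C Q :=
  @CounterSystem C Q (fun xy => step D xy.1 xy.2) (@step_size D).

End LocalTransitions.

(* Main.v *)
Require Import Defs.
From mathcomp Require Import classical_sets.
From mathcomp Require Import all_boot.
From mathcomp Require Import zify.

(** A step splits the users of each state [p] into those that stay and those
that move to a given [q]; summing this flow over targets gives the source of
the step, summing it over origins gives the target. If the source (or the
target) is enlarged in the sense of [prec0], the additional processes of a
state can be sent along a part of the flow that is already non-empty. The flow
then grows without changing its support, so that the opposite end of the step
also grows in the sense of [prec0]. Each transition type only constrains the
support of the flow and of the two configurations, and whether someone stays. *)

Set Implicit Arguments.
Unset Strict Implicit.
Unset Printing Implicit Defensive.

Definition le0 (a b : nat) : Prop := a <= b /\ (a = 0 <-> b = 0).

Lemma le0_refl a : le0 a a.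
Proof. by split. Qed.

Lemma le0_add a b c d : le0 a b -> le0 c d -> le0 (a + c) (b + d).
Proof. rewrite /le0; lia. Qed.

Lemma le0_sum (T : finType) (f g : T -> nat) :
  (forall t, le0 (f t) (g t)) -> le0 (\sum_t f t) (\sum_t g t).
Proof.
by move=> fg; apply: (big_ind2 le0) => //; exact: le0_add.
Qed.

Lemma le0_gt0 a b : le0 a b -> (0 < b) = (0 < a).
Proof. rewrite /le0; lia. Qed.

(** The whole surplus [n - \sum_u f u] goes to a single index where [f] is already positive, so
    every zero of [f] stays zero; if there is no such index, nothing is added. *)
Definition inflate (T : finType) (f : T -> nat) (n : nat) (t : T) : nat :=
  f t + (if [pick u | 0 < f u] == Some t then n - \sum_u f u else 0).

Lemma le0_inflate (T : finType) (f : T -> nat) n t : le0 (f t) (inflate f n t).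
Proof.
rewrite /inflate; case: pickP => [u fu|_] /=; last by rewrite addn0; exact: le0_refl.
case: eqP => [[<-]|_]; rewrite /le0; lia.
Qed.

(** When [f] vanishes everywhere, no index can take the surplus, but then the equivalence in [le0]
    forces [n = 0]. *)
Lemma sum_inflate (T : finType) (f : T -> nat) n :
  le0 (\sum_t f t) n -> \sum_t inflate f n t = n.
Proof.
move=> [le_n eq0]; rewrite /inflate big_split /= -big_mkcond /=.
case: pickP => [u fu|f0].
  by rewrite [X in _ + X](big_pred1 u) ?subnKC.
rewrite [X in _ + X]big_pred0 ?addn0 //.
have s0 : \sum_t f t = 0 by apply: big1 => t _; have := f0 t; lia.
by rewrite s0; apply/esym/eq0.
Qed.

Lemma sum_option (T : finType) (f : option T -> nat) :
  \sum_u f u = f None + \sum_t f (Some t).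
Proof.
rewrite (bigD1 None) //=; congr (_ + _).
rewrite (reindex_omap Some id) /=; last by case.
by apply: eq_bigl => t; rewrite eqxx.
Qed.

Section Flows.

Variables C Q : finType.
Implicit Types (x y : config C Q) (o : option (C * C)) (m : {ffun Q * Q -> nat}).

Definition controller_moves o x y : Prop :=
  if o is Some (p, q) then x.1 = p /\ y.1 = q else y.1 = x.1.

(** Naming the number [s p] of users that stay in [p] replaces truncated subtraction by sums and
    makes the two ends of a step symmetric. *)
Lemma movesP o m x y :
  moves o m x y <->
  exists s : Q -> nat, [/\ controller_moves o x y,
    forall p, x.2 p = s p + \sum_q m (p, q)
    & forall q, y.2 q = s q + \sum_p m (p, q)].
Proof.
split=> [[cxy le_m ym]|[s [cxy xs ys]]].
  exists (fun p => x.2 p - \sum_q m (p, q)); split=> // p.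
  by rewrite subnK.
by split=> // p; rewrite ?ys xs ?addnK ?leq_addl.
Qed.

(** By the second clause, where all users of a state move, the added ones move too, as
    synchronization requires. *)
Definition grows m x m' x' : Prop :=
  (forall t, le0 (m t) (m' t)) /\
  (forall p, \sum_q m (p, q) = x.2 p -> \sum_q m' (p, q) = x'.2 p).

Lemma moves_forward o m x y x' :
  moves o m x y -> prec0 x x' ->
  exists m' y', [/\ moves o m' x' y', prec0 y y' & grows m x m' x'].
Proof.
case/movesP=> s [cxy xs ys] [x1 xx'].
(* The users of [p] are indexed by destination, with [None] for those that stay, so one inflation
   treats staying and moving users alike. *)
pose f p u := if u is Some q then m (p, q) else s p.
pose f' p := inflate (f p) (x'.2 p).
pose m' := [ffun t : Q * Q => f' t.1 (Some t.2)].
have fx p : \sum_u f p u = x.2 p by rewrite sum_option xs.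
have f'x p : f' p None + \sum_q m' (p, q) = x'.2 p.
  rewrite (eq_bigr (fun q => f' p (Some q))) => [|q _]; last by rewrite ffunE.
  by rewrite -sum_option sum_inflate // fx; exact: xx'.
have mm' t : le0 (m t) (m' t).
  by case: t => p q; rewrite ffunE; exact: (le0_inflate (f p) _ (Some q)).
have ss' p : le0 (s p) (f' p None) := le0_inflate (f p) _ None.
exists m', (y.1, [ffun q => f' q None + \sum_p m' (p, q)]); split.
- apply/movesP; exists (fun p => f' p None); split=> [|p|q] /=.
  + by move: cxy; rewrite /controller_moves /= -x1.
  + by rewrite f'x.
  + by rewrite ffunE.
- split=> // q; rewrite ffunE ys.
  by apply: le0_add => //; apply: le0_sum.
(* If all users of [p] move, then [s p = 0], and inflation keeps this zero. *)
- split=> // p; rewrite xs => /esym/eqP; rewrite -[X in _ == X]add0n eqn_add2r.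
  by move/eqP => s0; rewrite -f'x ((ss' p).2.1 s0).
Qed.

Lemma moves_backward o m x y y' :
  moves o m x y -> prec0 y y' ->
  exists m' x', [/\ moves o m' x' y', prec0 x x' & grows m x m' x'].
Proof.
case/movesP=> s [cxy xs ys] [y1 yy'].
(* Here the users of [q] after the step are indexed by origin: inflation meets the given target, and
   the source is recomputed from the flow. *)
pose f q u := if u is Some p then m (p, q) else s q.
pose f' q := inflate (f q) (y'.2 q).
pose m' := [ffun t : Q * Q => f' t.2 (Some t.1)].
have fy q : \sum_u f q u = y.2 q by rewrite sum_option ys.
have f'y q : f' q None + \sum_p m' (p, q) = y'.2 q.
  rewrite (eq_bigr (fun p => f' q (Some p))) => [|p _]; last by rewrite ffunE.
  by rewrite -sum_option sum_inflate // fy; exact: yy'.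
have mm' t : le0 (m t) (m' t).
  by case: t => p q; rewrite ffunE; exact: (le0_inflate (f q) _ (Some p)).
have ss' p : le0 (s p) (f' p None) := le0_inflate (f p) _ None.
exists m', (x.1, [ffun p => f' p None + \sum_q m' (p, q)]); split.
- apply/movesP; exists (fun p => f' p None); split=> [|p|q] /=.
  + by move: cxy; rewrite /controller_moves /= -y1.
  + by rewrite ffunE.
  + by rewrite f'y.
- split=> // p; rewrite ffunE xs.
  by apply: le0_add => //; apply: le0_sum.
- split=> // p; rewrite xs => /esym/eqP; rewrite -[X in _ == X]add0n eqn_add2r.
  by move/eqP => s0; rewrite ffunE ((ss' p).2.1 s0).
Qed.

End Flows.

Section Steps.

Variables C Q Sigma : finType.
Implicit Types (x y : config C Q) (o : option (C * C)) (m : {ffun Q * Q -> nat}).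

(** Growth preserves zeros, so [m'] is still concentrated on [t]. *)
Lemma copies_grow k t m' : 0 < k ->
  (forall s, le0 (copies k t s) (m' s)) ->
  exists2 k', 0 < k' & m' = copies k' t.
Proof.
move=> k0 mm'; exists (m' t).
  by have := mm' t; rewrite ffunE eqxx /le0; lia.
apply/ffunP => s; have := mm' s; rewrite !ffunE /le0.
by case: eqP => [->|_] // [_ [->]].
Qed.

Lemma one_or_more_grow (e : edge C Q) o m m' :
  one_or_more e o m -> (forall t, le0 (m t) (m' t)) -> one_or_more e o m'.
Proof.
case=> [t|t k k0] mm'; last by have [k' k'0 ->] := copies_grow k0 mm'; constructor.
suff -> : m' = [ffun=> 0] by constructor.
by apply/ffunP => s; case: (mm' s) => _; rewrite !ffunE => -[->].
Qed.

(* The additional moves [t] are attributed to the senders, so that the receivers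
   taking [t] are unchanged. *)
Lemma broadcast_grow k t m m' : 0 < k ->
  (forall s, le0 ([ffun s => copies k t s + m s] s) (m' s)) ->
  exists k' m'', [/\ 0 < k', forall s, le0 (m s) (m'' s)
    & m' = [ffun s => copies k' t s + m'' s]].
Proof.
move=> k0 mm'; exists (m' t - m t), [ffun s => if s == t then m t else m' s].
split.
- by have := mm' t; rewrite !ffunE eqxx /le0; lia.
- move=> s; have := mm' s; rewrite !ffunE.
  by case: eqP => [->|_] //; rewrite add0n.
- apply/ffunP => s; have [+ _] := mm' s; rewrite !ffunE.
  by case: eqP => [->|_] // le_m; rewrite subnK //; lia.
Qed.

Lemma only_in_grow (A : {set edge C Q}) o m m' :
  only_in A o m -> (forall t, le0 (m t) (m' t)) -> only_in A o m'.
Proof. by case=> Ao Am mm'; split=> // t; rewrite (le0_gt0 (mm' t)); apply: Am. Qed.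

Lemma synchronized_grow (A : {set edge C Q}) o m x m' x' :
  synchronized A o m x -> prec0 x x' -> grows m x m' x' ->
  synchronized A o m' x'.
Proof.
move=> [Am Ac Au] [x1 _] [mm' full]; split; rewrite -?x1 //.
  exact: only_in_grow mm'.
by move=> p /Au /full.
Qed.

Lemma sat_exists_prec0 (G : {set C + Q}) x x' :
  prec0 x x' -> sat_exists G x -> sat_exists G x'.
Proof.
move=> [x1 xx'] [Gx|[r Gr xr]]; [left | right; exists r] => //.
  by rewrite -x1.
by rewrite (le0_gt0 (xx' r)).
Qed.

(** Equality matters: the guard [support x \subset GA] would not survive a growing support. *)
Lemma support_prec0 x x' : prec0 x x' -> Defs.support x = Defs.support x'.
Proof.
move=> [x1 xx']; apply/setP => -[c|q]; rewrite !inE ?x1 //.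
by rewrite (le0_gt0 (xx' q)).
Qed.

(** The case analysis on transition types happens once here, in a form that does not say which end
    was enlarged, so it serves both directions of compatibility. *)
Lemma step_grow (D : local_transitions C Q Sigma) x y :
  step D x y ->
  exists o m, moves o m x y /\
    forall m' x' y', prec0 x x' -> prec0 y y' -> grows m x m' x' ->
      moves o m' x' y' -> step D x' y'.
Proof.
case.
- move=> e o m De em mv; exists o, m; split=> // m' x' y' _ _ [mm' _].
  exact/(InternalStep De)/(one_or_more_grow em).
- move=> t a m Dt rm mv; exists (Some t), m; split=> // m' x' y' _ _ [mm' _].
  exact/(ControllerBroadcastStep Dt)/(only_in_grow rm).
- move=> t k a o m Dt k0 rm mv; eexists o, _; split; first exact: mv.
  move=> m' x' y' _ _ [mm' _].
  have [k' [m'' [k'0 mm'' ->]]] := broadcast_grow k0 mm'.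
  exact/(UserBroadcastStep Dt k'0)/(only_in_grow rm).
- move=> e G o m De em Gx Gy mv; exists o, m; split=> // m' x' y' xx' yy' [mm' _].
  apply: (DisjunctiveStep De); first exact: one_or_more_grow mm'.
    exact: sat_exists_prec0 Gx.
  exact: sat_exists_prec0 Gy.
- move=> e a o m De sm mv; exists o, m; split=> // m' x' y' xx' _ mm'.
  exact/(SyncStep De)/(synchronized_grow sm).
- move=> e a GE GA o m De GEx GAx sm mv; exists o, m; split=> // m' x' y' xx' _ mm'.
  rewrite (support_prec0 xx') in GEx GAx.
  exact/(GuardedSyncStep De GEx GAx)/(synchronized_grow sm).
- move=> t a k Dt k0 mv; eexists _, _; split; first exact: mv.
  (* The controller move of a write starts at [x.1], so it is restated from [x'.1]. *)
  move=> m' x' y' [-> _] _ [mm' _].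
  by have [k' k'0 ->] := copies_grow k0 mm'; apply: WriteStep.
- move=> t a k Dt k0 mv; eexists _, _; split; first exact: mv.
  move=> m' x' y' _ _ [mm' _].
  by have [k' k'0 ->] := copies_grow k0 mm'; apply: ReadStep.
Qed.

Lemma induced_system_compatible (D : local_transitions C Q Sigma) :
  fully_compatible (induced_system D).
Proof.
split=> x y z /step_grow [o [m [mv grow]]] le_z.
  have [m' [y' [mv' yy' mm']]] := moves_forward mv le_z.
  by exists y' => //; apply: grow mv'.
have [m' [x' [mv' xx' mm']]] := moves_backward mv le_z.
by exists x' => //; apply: grow mv'.
Qed.

End Steps.

(** The matching step is found in the same part as the given one, hence in the union. *)
Lemma partition_compatible (C Q : finType) (S : counter_system C Q)
    (I : Type) (Si : I -> counter_system C Q) :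
  classical_sets.partition (@classical_sets.setT I)
    (fun i => steps (Si i)) (steps S) ->
  (forall i, fully_compatible (Si i)) -> fully_compatible S.
Proof.
case=> cov _ _ Si_compat; rewrite /fully_compatible.
rewrite /forward_compatible /backward_compatible -cov.
split=> x y z [i _ xy] le_z.
  by have [y' ? ?] := (Si_compat i).1 _ _ _ xy le_z; exists y' => //; exists i.
by have [x' ? ?] := (Si_compat i).2 _ _ _ xy le_z; exists x' => //; exists i.
Qed.

Theorem theorem1 :
  (forall (C Q : finType) (S : counter_system C Q)
      (I : Type) (Si : I -> counter_system C Q),
    classical_sets.partition (@classical_sets.setT I)
      (fun i => steps (Si i)) (steps S) ->
    (forall i, fully_compatible (Si i)) ->
    fully_compatible S) /\
  (forall (C Q Sigma : finType) (D : local_transitions C Q Sigma),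
    fully_compatible (induced_system D)).
Proof.
by split; [exact: partition_compatible | exact: induced_system_compatible].
Qed.
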